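(* For every $r\in(0,1)$ there is a constant $C_r$ depending only on $r$ such that for all $k\ge0$, $$\sup_{n\ge1}\ n^{-1}\,\mathbb{E}[X_{>k}(n)]\le C_r\, r^k .$$
   Context: A plane increasing tree on $[n]$ is a rooted tree with vertex set $[n]$ in which every non-root vertex has a larger label than its parent (the root is $1$) and the children of each vertex are linearly ordered. Let $T_n$ be uniformly random among the $(2n-3)!!$ such trees. The rank of a vertex $v$ is the number of edges of a shortest path from $v$ down to a leaf descendant of $v$. $X_{>k}(n)$ denotes the number of vertices of rank strictly greater than $k$ in $T_n$. *)

(* Defs.v *)
From HB Require Import structures.
From mathcomp Require Import all_boot all_order all_algebra.
From mathcomp Require Import all_classical all_reals all_analysis.

Set Implicit Arguments.
Unset Strict Implicit.
Unset Printing Implicit Defensive.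

Import Order.TTheory GRing.Theory Num.Theory.

(* The vertex i : 'I_n stands for the label i + 1 of [n], so the root (label 1)
   is the vertex of value 0.  A plane tree is given by its ordered lists of
   children: every non-root vertex occurs exactly once in all these lists taken
   together (it has exactly one parent), and the root never occurs.  Since each
   parent has a smaller label than its children, going up from any vertex ends
   at the root, so there are no cycles and the graph is connected.  Bounding the
   length of the lists by n loses nothing, as they are duplicate-free. *)
Definition plane_increasing (n : nat) (c : {ffun 'I_n -> n.-bseq 'I_n}) :
    bool :=
  [forall u : 'I_n, (\sum_(v < n) count_mem u (c v))%N == (val u != 0%N) :> nat]
  && [forall v : 'I_n, all (fun u : 'I_n => (v < u)%N) (c v)].

Definition plane_inc_tree (n : nat) : Type :=
  {c : {ffun 'I_n -> n.-bseq 'I_n} | plane_increasing c}.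

HB.instance Definition _ n := Finite.on (plane_inc_tree n).

Definition children (n : nat) (t : plane_inc_tree n) (v : 'I_n) : seq 'I_n := sval t v.

Definition child_of (n : nat) (t : plane_inc_tree n) : rel 'I_n :=
  fun v u => u \in children t v.

Definition is_leaf (n : nat) (t : plane_inc_tree n) (v : 'I_n) : bool :=
  nilp (children t v).

Definition leaf_at_depth (n : nat) (t : plane_inc_tree n) (v : 'I_n) (d : nat) : bool :=
  [exists p : d.-tuple 'I_n, path (child_of t) v p && is_leaf t (last v p)].

Lemma leaf_at_depth_ex (n : nat) (t : plane_inc_tree n) (v : 'I_n) :
  exists d, leaf_at_depth t v d.
Proof.
have [m] := ubnP (n - v); elim: m v => // m IHm v lt_m.
case cv: (children t v) => [|u s].
  by exists 0; apply/existsP; exists [tuple]; rewrite /= /is_leaf cv.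
have uv : child_of t v u by rewrite /child_of cv inE eqxx.
have lt_vu : (v < u)%N.
  have /andP[_ /forallP/(_ v)/allP] := svalP t.
  by move/(_ u); apply.
have [|d /existsP[p /andP[pp lp]]] := IHm u.
  rewrite ltnS in lt_m; apply: leq_trans lt_m.
  by apply: ltn_sub2l => //; apply: ltn_ord.
by exists d.+1; apply/existsP; exists [tuple of u :: p]; rewrite /= uv pp.
Qed.

Definition vertex_rank (n : nat) (t : plane_inc_tree n) (v : 'I_n) : nat :=
  ex_minn (leaf_at_depth_ex t v).

Definition num_rank_gt (n : nat) (t : plane_inc_tree n) (k : nat) : nat :=
  #|[pred v : 'I_n | (k < vertex_rank t v)%N]|.

Local Open Scope ring_scope.

(* Expectation of num_rank_gt for the uniform distribution. *)
Definition expected_num_rank_gt (R : realType) (n k : nat) : R :=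
  (\sum_(t : plane_inc_tree n) (num_rank_gt t k)%:R)
    / #|{: plane_inc_tree n}|%:R.

(* Main.v *)
(* The rank of a vertex u is at most the length d(u) of its spine, the path that
   starts at u and always goes to the first child.  With x = 1/r > 1, consider the
   weight W(t), the sum of x^d(u) over all vertices u.  A tree on n + 1 vertices
   arises uniquely by adding the last label to a tree t on n vertices at one of
   2n - 1 places.  The new vertex contributes 1, and spines change only if it
   becomes a first child; among these n insertions, those at the d(u) + 1 vertices
   of the spine of u give it the lengths 1, ..., d(u) + 1.  The resulting total change
   x + ... + x^(d(u)+1) - (d(u)+1) x^d(u) is bounded above by a constant K
   independent of d(u), so the mean of W grows by at most 1 + K per step, and
   x^k E[X_{>k}(n)] <= E[W] <= (1 + K) n. *)

Require Import Defs.
From mathcomp Require Import all_boot all_order all_algebra.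
From mathcomp Require Import all_classical all_reals all_analysis.
From mathcomp Require Import zify ring lra.

Import Order.TTheory GRing.Theory Num.Theory.
Local Open Scope classical_set_scope.
Local Open Scope ring_scope.

(** * Spines of first-child functions and their change under a new first child *)

Definition spine_fun (f : nat -> option nat) (d : nat -> nat) : Prop :=
  forall u, d u = if f u is Some w then (d w).+1 else 0%N.

Definition increasing_below (n : nat) (f : nat -> option nat) : Prop :=
  forall u w, f u = Some w -> (u < w < n)%N.

(** The fuel only makes the recursion structural. Along a spine the labels increase and stay below
    the bound [n], so every fuel of at least [n - u] gives the same value. Later arguments use the
    fuel-free equation [spine_fun]. *)
Fixpoint spine_length (f : nat -> option nat) (fuel u : nat) : nat :=
  if fuel is k.+1 then if f u is Some w then (spine_length f k w).+1 else 0%N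
  else 0%N.

Lemma spine_length_fuel {f n} (fP : increasing_below n f) {k k' u} :
  (n - u <= k)%N -> (n - u <= k')%N -> spine_length f k u = spine_length f k' u.
Proof.
elim: k k' u => [|k IHk] [|k'] u //= le_k le_k'; case fu: (f u) => [w|] //;
  have /andP[lt_uw lt_wn] := fP _ _ fu; try by lia.
by congr _.+1; apply: IHk; lia.
Qed.

Lemma spine_lengthP {f n} : increasing_below n f -> spine_fun f (spine_length f n).
Proof.
move=> fP u; case: n fP => [|n] fP /=.
  by case fu: (f u) => [w|] //; have := fP _ _ fu; rewrite ltn0 andbF.
case fu: (f u) => [w|] //; have /andP[lt_uw lt_wn] := fP _ _ fu.
congr _.+1; rewrite -[RHS]/(spine_length f n.+1 w).
by apply: (spine_length_fuel fP); lia.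
Qed.

(** A spine that starts above [v] only meets labels larger than [v], so it cannot notice a change of
    the first-child function at [v]. *)
Lemma spine_fun_unique {f g n d d'} v : increasing_below n f ->
  (forall u, (v < u < n)%N -> g u = f u) ->
  spine_fun f d -> spine_fun g d' -> forall u, (v < u < n)%N -> d' u = d u.
Proof.
move=> fP fg dP d'P u; have [m] := ubnP (n - u).
elim: m u => // m IHm u lt_m lt_vu; rewrite dP d'P fg //.
case fu: (f u) => [w|] //; have /andP[lt_uw lt_wn] := fP _ _ fu.
by rewrite IHm //; lia.
Qed.

Definition new_first_child (f : nat -> option nat) (n v u : nat) : option nat :=
  if u == v then Some n else f u.

(* As v runs over all vertices, the spine of u is cut and redirected to the new
   leaf at each of its d u + 1 vertices, and left unchanged otherwise. *)
Lemma sum_spine_new_first_child {V : zmodType} {f n d} {d' : nat -> nat -> nat}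
    (F : nat -> V) u :
  increasing_below n f -> spine_fun f d ->
  (forall v, (v < n)%N -> spine_fun (new_first_child f n v) (d' v)) ->
  (u < n)%N ->
  \sum_(v < n) (F (d' v u) - F (d u)) = \sum_(i < (d u).+1) (F i.+1 - F (d u)).
Proof.
move=> fP dP d'P; have [m] := ubnP (n - u).
elim: m u F => // m IHm u F lt_m lt_un.
have d'n v : (v < n)%N -> d' v n = 0%N.
  move=> lt_vn; rewrite d'P // /new_first_child eqn_leq leqNgt lt_vn /=.
  by case fn: (f n) => [w|] //; have := fP _ _ fn; lia.
(* The choice [v = u] cuts the spine of [u] to length 1; it yields the term [i = 0] on the right. *)
rewrite (bigD1 (Ordinal lt_un)) //=.
have -> : d' u u = 1%N by rewrite d'P // /new_first_child eqxx d'n.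
have d'u (v : 'I_n) : v != Ordinal lt_un ->
    d' v u = if f u is Some w then (d' v w).+1 else 0%N.
  rewrite -val_eqE /= => neq_vu; rewrite d'P // /new_first_child.
  by rewrite eq_sym (negPf neq_vu).
have du := dP u; case fu: (f u) du d'u => [w|] -> d'u; last first.
  by rewrite big_ord1 big1 ?addr0 // => v neq_vu; rewrite d'u // subrr.
have /andP[lt_uw lt_wn] := fP _ _ fu.
rewrite big_ord_recl; congr (_ + _).
(* For [v != u] the spine of [u] stays one longer than that of its first child [w], so the induction
   hypothesis is used at [w] with [F] shifted by one. *)
transitivity (\sum_(v < n) (F (d' v w).+1 - F (d w).+1)); last first.
  by rewrite (IHm w (F \o S)) //; lia.
(* The sum for [w] also contains [v = u]; that term is zero because the spine of [w] lies above
   [u]. *)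
rewrite [RHS](bigD1 (Ordinal lt_un)) //=.
have -> : d' u w = d w.
  apply: (spine_fun_unique u fP _ dP (d'P u lt_un)); last by lia.
  by move=> y lt_uy; rewrite /new_first_child gtn_eqF //; lia.
by rewrite subrr add0r; apply: eq_bigr => v neq_vu; rewrite d'u.
Qed.

(** * Codes of plane increasing trees and insertion of the last leaf *)

(* Entry v is the ordered list of children of v, for v = 0, ..., n; hence the
   code [tree_code n] has n + 1 vertices. *)
Record tree_code (n : nat) (s : seq (seq nat)) : Prop := TreeCode {
  tree_code_size : size s = n.+1;
  tree_code_perm : perm_eq (flatten s) (iota 1 n);
  tree_code_lt : forall v u, u \in nth [::] s v -> (v < u)%N }.

(** The vertices are 0, ..., [size s - 1], so [size s] is the next free label. The entry appended at
    the end is the empty child list of the new leaf. *)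
Definition insert_leaf (s : seq (seq nat)) (v i : nat) : seq (seq nat) :=
  let c := nth [::] s v in
  rcons (set_nth [::] s v (take i c ++ size s :: drop i c)) [::].

Definition first_child (s : seq (seq nat)) (v : nat) : option nat :=
  ohead (nth [::] s v).

Lemma mem_nth_flatten {T : eqType} {s : seq (seq T)} {v : nat} {x : T} :
  x \in nth [::] s v -> x \in flatten s.
Proof.
have [lt_v|le_v] := ltnP v (size s); last by rewrite nth_default.
by move=> xs; apply/flattenP; exists (nth [::] s v); rewrite ?mem_nth.
Qed.

Lemma tree_code_ltn {n s v u} :
  tree_code n s -> u \in nth [::] s v -> (v < u < n.+1)%N.
Proof.
move=> sP us; rewrite (tree_code_lt _ _ sP) //=.
by have := mem_nth_flatten us; rewrite (perm_mem (tree_code_perm _ _ sP)) mem_iota; lia.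
Qed.

Lemma first_child_increasing {n s} :
  tree_code n s -> increasing_below n.+1 (first_child s).
Proof.
move=> sP u w; rewrite /first_child; case us: (nth _ _ _) => [//|y l] [<-].
by apply: (tree_code_ltn sP); rewrite us mem_head.
Qed.

Lemma nth_insert_leaf {s v} i u : (v < size s)%N ->
  nth [::] (insert_leaf s v i) u =
    if u == v then take i (nth [::] s v) ++ size s :: drop i (nth [::] s v)
    else nth [::] s u.
Proof.
move=> lt_v; rewrite /insert_leaf nth_rcons size_set_nth nth_set_nth /=.
have -> : maxn v.+1 (size s) = size s by lia.
case: (ltngtP u (size s)) => [//|lt_su|->].
- by rewrite (gtn_eqF (ltn_trans lt_v lt_su)) nth_default // ltnW.
- by rewrite gtn_eqF // nth_default.
Qed.

Lemma first_child_insert_leaf0 {s v} u : (v < size s)%N ->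
  first_child (insert_leaf s v 0) u = new_first_child (first_child s) (size s) v u.
Proof.
move=> lt_v; rewrite /first_child /new_first_child nth_insert_leaf //.
by case: eqP => // _; rewrite take0.
Qed.

Lemma first_child_insert_leafS {s v i} u : (v < size s)%N ->
  (i < size (nth [::] s v))%N ->
  first_child (insert_leaf s v i.+1) u = first_child s u.
Proof.
move=> lt_v; rewrite /first_child nth_insert_leaf //.
by case: eqP => // ->; case: (nth _ _ _).
Qed.

Lemma size_insert_leaf {s v} i : (v < size s)%N ->
  size (insert_leaf s v i) = (size s).+1.
Proof. by move=> lt_v; rewrite size_rcons size_set_nth; congr _.+1; lia. Qed.

Lemma perm_flatten_insert_leaf {s v} i : (v < size s)%N ->
  perm_eq (flatten (insert_leaf s v i)) (size s :: flatten s).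
Proof.
move=> lt_v; apply/permP => a; rewrite /insert_leaf set_nthE lt_v.
rewrite -[in flatten s](cat_take_drop v s) (drop_nth [::] lt_v).
set c := nth _ _ _; rewrite -[in c :: _](cat_take_drop i c).
rewrite -cats1 !(flatten_cat, count_cat, count_flatten, map_cat, sumn_cat) /=.
by rewrite !(count_cat, count_flatten) /=; lia.
Qed.

Lemma insert_leafP {n s v} i :
  tree_code n s -> (v <= n)%N -> tree_code n.+1 (insert_leaf s v i).
Proof.
move=> sP; rewrite -ltnS -(tree_code_size _ _ sP) => lt_v.
split; first by rewrite size_insert_leaf // (tree_code_size _ _ sP).
  apply: (perm_trans (perm_flatten_insert_leaf i lt_v)).
  rewrite (tree_code_size _ _ sP) -[X in iota 1 X]addn1 iotaD cats1 add1n.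
  by rewrite perm_sym perm_rcons perm_cons perm_sym (tree_code_perm _ _ sP).
move=> w u; rewrite nth_insert_leaf //; case: eqP => [->|_]; last first.
  exact: (tree_code_lt _ _ sP).
rewrite mem_cat inE orbCA => /predU1P[->//|]; rewrite -mem_cat cat_take_drop.
exact: (tree_code_lt _ _ sP).
Qed.

(** * Removal of the last leaf, the inverse of insertion *)

Definition remove_last_leaf (z : seq (seq nat)) : seq (seq nat) :=
  [seq [seq u <- c | u != (size z).-1] | c <- take (size z).-1 z].

Definition last_leaf_parent (z : seq (seq nat)) : nat :=
  find (fun c => (size z).-1 \in c) z.

Definition last_leaf_index (z : seq (seq nat)) : nat :=
  index (size z).-1 (nth [::] z (last_leaf_parent z)).

Lemma tree_code_notin {n s} : tree_code n s -> size s \notin flatten s.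
Proof.
move=> sP; rewrite (perm_mem (tree_code_perm _ _ sP)) mem_iota.
by rewrite (tree_code_size _ _ sP); lia.
Qed.

Lemma filter_neq_notin {T : eqType} (x : T) (s : seq T) :
  x \notin s -> [seq y <- s | y != x] = s.
Proof.
by move=> xs; apply/all_filterP/allP => y ys; apply: contraNneq xs => <-.
Qed.

Lemma remove_insert_leaf {n s v} i : tree_code n s -> (v < size s)%N ->
  remove_last_leaf (insert_leaf s v i) = s.
Proof.
move=> sP lt_v; have sN := tree_code_notin sP.
have cN w : size s \notin nth [::] s w by apply: contra sN; apply: mem_nth_flatten.
rewrite /remove_last_leaf size_insert_leaf //=.
have lt_s : (size s < size (insert_leaf s v i))%N by rewrite size_insert_leaf.
apply: (@eq_from_nth _ [::]); first by rewrite size_map size_take lt_s.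
move=> w; rewrite size_map size_take lt_s => lt_w.
rewrite (nth_map [::]) ?size_take ?lt_s // nth_take // nth_insert_leaf //.
case: eqP => [->|_]; last exact: filter_neq_notin.
rewrite filter_cat /= eqxx -filter_cat cat_take_drop; exact: filter_neq_notin.
Qed.

Lemma parent_insert_leaf {n s v} i : tree_code n s -> (v < size s)%N ->
  last_leaf_parent (insert_leaf s v i) = v.
Proof.
move=> sP lt_v; have sN := tree_code_notin sP.
have cN w : size s \notin nth [::] s w by apply: contra sN; apply: mem_nth_flatten.
rewrite /last_leaf_parent size_insert_leaf //=.
set a := fun c => _; set z := insert_leaf s v i.
have az w : a (nth [::] z w) = (w == v).
  rewrite /a nth_insert_leaf //; case: eqP => _; last exact: negPf.
  by rewrite mem_cat mem_head orbT.
have hz : has a z.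
  apply/(has_nthP [::]); exists v; rewrite ?az ?eqxx // size_insert_leaf //.
  exact: ltnW.
by apply/eqP; rewrite -az nth_find.
Qed.

(** The bound on [i] matters: beyond the length of the child list [take] saturates, and all larger
    [i] give the same code. *)
Lemma index_insert_leaf {n s v i} : tree_code n s -> (v < size s)%N ->
  (i <= size (nth [::] s v))%N -> last_leaf_index (insert_leaf s v i) = i.
Proof.
move=> sP lt_v le_i; have sN := tree_code_notin sP.
rewrite /last_leaf_index (parent_insert_leaf _ sP) // nth_insert_leaf // eqxx.
rewrite size_insert_leaf //= index_cat ifN /= ?eqxx ?addn0 ?size_takel //.
by apply: contra sN => /mem_take; apply: mem_nth_flatten.
Qed.

Section RemoveLeaf.
Variables (n : nat) (z : seq (seq nat)).
Hypothesis zP : tree_code n.+1 z.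
Let s := remove_last_leaf z.
Let v := last_leaf_parent z.

Let sz : size z = n.+2 := tree_code_size _ _ zP.

Let nth_s w : (w <= n)%N ->
  nth [::] s w = [seq u <- nth [::] z w | u != n.+1].
Proof.
move=> le_w; rewrite /s /remove_last_leaf sz /=.
by rewrite (nth_map [::]) ?size_take ?sz ?ltnSn // nth_take.
Qed.

Let size_s : size s = n.+1.
Proof. by rewrite /s /remove_last_leaf size_map size_take sz ltnSn. Qed.

Let last_z w : (n < w)%N -> nth [::] z w = [::].
Proof.
move=> lt_w; case zw: (nth _ _ _) => [//|u l].
have: u \in nth [::] z w by rewrite zw mem_head.
by move/(tree_code_ltn zP); lia.
Qed.

(** The vertex [n.+1] carries the largest label, hence has no children, and dropping its entry loses
    no label. *)
Let flat_s : flatten s = [seq u <- flatten z | u != n.+1].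
Proof.
rewrite filter_flatten -[in RHS](cat_take_drop n.+1 z) map_cat flatten_cat.
rewrite (drop_nth [::]) ?sz // last_z // drop_oversize ?sz //= cats0.
by rewrite /s /remove_last_leaf sz.
Qed.

Lemma remove_last_leafP : tree_code n s.
Proof.
split=> //.
  rewrite flat_s; apply: perm_trans (perm_filter _ (tree_code_perm _ _ zP)) _.
  rewrite -[X in iota 1 X]addn1 iotaD filter_cat /= add1n eqxx cats0.
  by rewrite filter_neq_notin // mem_iota; lia.
move=> w u; have [le_w|lt_w] := leqP w n; last by rewrite nth_default ?size_s.
by rewrite nth_s // mem_filter => /andP[_]; apply: (tree_code_lt _ _ zP).
Qed.

Let uniq_z : uniq (flatten z).
Proof. by rewrite (perm_uniq (tree_code_perm _ _ zP)) iota_uniq. Qed.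

Let has_z : has (fun c => n.+1 \in c) z.
Proof.
have: n.+1 \in flatten z by rewrite (perm_mem (tree_code_perm _ _ zP)) mem_iota; lia.
by case/flattenP=> c cz nc; apply/hasP; exists c.
Qed.

Let in_zv : n.+1 \in nth [::] z v.
Proof. by rewrite /v /last_leaf_parent sz /=; apply: (nth_find [::] has_z). Qed.

Lemma last_leaf_parent_le : (v <= n)%N.
Proof. by have := tree_code_ltn zP in_zv; lia. Qed.

Let uniq_zw w : uniq (nth [::] z w).
Proof.
have [lt_w|le_w] := ltnP w (size z); last by rewrite nth_default.
move: uniq_z; rewrite -(cat_take_drop w z) (drop_nth [::] lt_w) flatten_cat /=.
by rewrite !cat_uniq => /and3P[_ _ /and3P[]]; rewrite nth_cat size_take lt_w ltnn subnn.
Qed.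

Let split_zv : nth [::] z v =
  take (last_leaf_index z) (nth [::] s v) ++ n.+1 :: drop (last_leaf_index z) (nth [::] s v).
Proof.
rewrite nth_s ?last_leaf_parent_le // /last_leaf_index -/v sz /=.
have := uniq_zw v; case/splitPr: in_zv => a b; rewrite cat_uniq /= => /and4P[_].
rewrite negb_or => /andP[na _] nb _.
rewrite filter_cat /= eqxx !filter_neq_notin // index_cat (negPf na) /= eqxx addn0.
by rewrite take_size_cat // drop_size_cat.
Qed.

(** The parent is unique: a second list containing [n.+1] would give this label multiplicity at
    least 2 in the duplicate-free [flatten z]. *)
Let notin_zw w : w != v -> n.+1 \notin nth [::] z w.
Proof.
move=> neq_wv; apply/negP => in_w.
have lt_w : (w < size z)%N.
  by rewrite ltnNge; apply: contraL in_w => le_w; rewrite nth_default.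
have lt_v : (v < size z)%N.
  by rewrite ltnNge; apply: contraL in_zv => le_w; rewrite nth_default.
have := count_uniq_mem n.+1 uniq_z; rewrite count_flatten sumnE big_map.
rewrite (big_nth [::]) big_mkord (bigD1 (Ordinal lt_w)) //=.
rewrite (bigD1 (Ordinal lt_v)) /= -?val_eqE 1?eq_sym // !count_uniq_mem //.
by rewrite in_w in_zv; case: (_ \in flatten _).
Qed.

Lemma insert_remove_leaf : insert_leaf s v (last_leaf_index z) = z.
Proof.
have lt_v : (v < size s)%N by rewrite size_s ltnS last_leaf_parent_le.
apply: (@eq_from_nth _ [::]) => [|w _]; first by rewrite size_insert_leaf // size_s.
rewrite nth_insert_leaf //; case: eqP => [->|/eqP neq_wv].
  by rewrite split_zv size_s.
have [le_w|lt_w] := leqP w n; last by rewrite last_z // nth_default ?size_s.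
by rewrite nth_s // filter_neq_notin // notin_zw.
Qed.

Lemma last_leaf_index_le : (last_leaf_index z <= size (nth [::] s v))%N.
Proof.
have := in_zv; rewrite -index_mem -ltnS => lt_i.
have := congr1 size split_zv; rewrite size_cat /= -addSnnS addSn -size_cat cat_take_drop.
by rewrite /last_leaf_index -/v sz /=; move: lt_i => /[swap] ->; rewrite !ltnS.
Qed.

End RemoveLeaf.

(** * Enumeration of all codes by successive insertions *)

Definition leaf_positions (s : seq (seq nat)) : seq (nat * nat) :=
  [seq (v, i) | v <- iota 0 (size s), i <- iota 0 (size (nth [::] s v)).+1].

Fixpoint tree_codes (n : nat) : seq (seq (seq nat)) :=
  if n is m.+1 then
    [seq insert_leaf s p.1 p.2 | s <- tree_codes m, p <- leaf_positions s]
  else [:: [:: [::]]].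

Lemma mem_leaf_positions s v i :
  ((v, i) \in leaf_positions s) = (v < size s)%N && (i <= size (nth [::] s v))%N.
Proof.
apply/allpairsPdep/andP => [[w [j [ws js [-> ->]]]]|[lt_v le_i]].
  by move: ws js; rewrite !mem_iota; lia.
by exists v, i; rewrite !mem_iota.
Qed.

Lemma leaf_positions_uniq s : uniq (leaf_positions s).
Proof.
apply: allpairs_uniq_dep => [|v _|]; try exact: iota_uniq.
by move=> [v i] [w j] _ _ /= [-> ->].
Qed.

(** Completeness of the enumeration: a code on one more vertex is recovered by removing its last
    leaf and inserting it again at the recorded parent and index. *)
Lemma mem_tree_codes n s : s \in tree_codes n <-> tree_code n s.
Proof.
elim: n s => [|n IHn] z.
  rewrite inE; split => [/eqP->|[]].
    by split=> // -[|[|v]] u.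
  case: z => [|c [|//]] // _; rewrite /= cats0 => /perm_size/size0nil-> _.
  exact: eqxx.
split.
  case/allpairsPdep => s [[v i] [/IHn sP]]; rewrite mem_leaf_positions => /andP[lt_v _] ->.
  by apply: insert_leafP => //; rewrite -ltnS -(tree_code_size _ _ sP).
move=> zP; have sP := remove_last_leafP _ _ zP; apply/allpairsPdep.
exists (remove_last_leaf z), (last_leaf_parent z, last_leaf_index z).
split; [exact/IHn | | by rewrite (insert_remove_leaf _ _ zP)].
rewrite mem_leaf_positions (tree_code_size _ _ sP) ltnS.
by rewrite (last_leaf_parent_le _ _ zP) (last_leaf_index_le _ _ zP).
Qed.

(** No code is produced twice, since the smaller code, the parent and the index can all be read off
    from the result of an insertion. *)
Lemma tree_codes_uniq n : uniq (tree_codes n).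
Proof.
elim: n => //= n IHn; apply: allpairs_uniq_dep => // [s _|].
  exact: leaf_positions_uniq.
move=> p q /allpairsPdep[s [[v i] [/mem_tree_codes sP vi ->]]].
case/allpairsPdep=> s' [[v' i'] [/mem_tree_codes s'P vi' ->]] /= eq_ins.
move: vi vi'; rewrite !mem_leaf_positions => /andP[lt_v le_i] /andP[lt_v' le_i'].
have es : s = s'.
  by rewrite -(remove_insert_leaf i sP lt_v) eq_ins (remove_insert_leaf i' s'P).
have ev : v = v'.
  by rewrite -(parent_insert_leaf i sP lt_v) eq_ins (parent_insert_leaf i' s'P).
have ei : i = i'.
  by rewrite -(index_insert_leaf sP lt_v le_i) eq_ins (index_insert_leaf s'P).
by rewrite es ev ei.
Qed.

Lemma sum_tree_codesS {V : nmodType} (F : seq (seq nat) -> V) n :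
  \sum_(z <- tree_codes n.+1) F z =
  \sum_(s <- tree_codes n)
    \sum_(v < n.+1) \sum_(i < (size (nth [::] s v)).+1) F (insert_leaf s v i).
Proof.
rewrite /= big_allpairs_dep; apply: eq_big_seq => s /mem_tree_codes sP.
rewrite big_allpairs_dep (tree_code_size _ _ sP).
rewrite -[iota 0 _]/(index_iota 0 n.+1) big_mkord; apply: eq_bigr => v _.
by rewrite -[iota 0 _]/(index_iota 0 _.+1) big_mkord.
Qed.

Lemma sum_size_children {n s} :
  tree_code n s -> (\sum_(v < n.+1) size (nth [::] s v))%N = n.
Proof.
move=> sP; have := perm_size (tree_code_perm _ _ sP).
rewrite size_iota size_flatten sumnE big_map (big_nth [::]).
by rewrite (tree_code_size _ _ sP) big_mkord.
Qed.

(** A child list of length c has c + 1 gaps. The n + 1 lists contain n children in total, which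
    makes 2n + 1 places for the new leaf in every code. *)
Lemma size_tree_codesS n :
  size (tree_codes n.+1) = (n.*2.+1 * size (tree_codes n))%N.
Proof.
rewrite -!sum1_size (sum_tree_codesS (fun=> 1%N)) big_distrr /=.
apply: eq_big_seq => s /mem_tree_codes sP.
under eq_bigr do rewrite sum1_card card_ord -addn1.
by rewrite big_split /= (sum_size_children sP) sum1_card card_ord; lia.
Qed.

(** * Growth of the total spine weight under insertion *)

Definition code_spine (s : seq (seq nat)) : nat -> nat :=
  spine_length (first_child s) (size s).

Lemma code_spineP {n s} : tree_code n s -> spine_fun (first_child s) (code_spine s).
Proof.
move=> sP; apply: spine_lengthP; rewrite (tree_code_size _ _ sP).
exact: first_child_increasing.
Qed.

Section SpineWeight.
Context {R : realType}.
Variable x : R.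

Definition spine_weight (s : seq (seq nat)) : R :=
  \sum_(u < size s) x ^+ code_spine s u.

Lemma spine_weight_insert_leaf {n s} v i : tree_code n s -> (v <= n)%N ->
  spine_weight (insert_leaf s v i) =
    1 + \sum_(u < n.+1) x ^+ code_spine (insert_leaf s v i) u.
Proof.
move=> sP le_v; have lt_v : (v < size s)%N by rewrite (tree_code_size _ _ sP).
have zP := insert_leafP i sP le_v.
rewrite /spine_weight (tree_code_size _ _ zP) big_ord_recr /= addrC; congr (_ + _).
rewrite (code_spineP zP) /first_child nth_insert_leaf //.
by rewrite gtn_eqF // nth_default // (tree_code_size _ _ sP).
Qed.

Lemma spine_weight_insert_leafS {n s v i} : tree_code n s -> (v <= n)%N ->
  (i < size (nth [::] s v))%N ->
  spine_weight (insert_leaf s v i.+1) = 1 + spine_weight s.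
Proof.
move=> sP le_v lt_i; have lt_v : (v < size s)%N by rewrite (tree_code_size _ _ sP).
rewrite (spine_weight_insert_leaf _ _ sP) // /spine_weight (tree_code_size _ _ sP).
congr (_ + _); apply: eq_bigr => u _; congr (_ ^+ _).
have zP := insert_leafP i.+1 sP le_v.
have fP := first_child_increasing sP.
rewrite /code_spine (tree_code_size _ _ zP) (tree_code_size _ _ sP).
have -> : first_child (insert_leaf s v i.+1) = first_child s.
  by apply/funext => w; apply: first_child_insert_leafS.
by apply: (spine_length_fuel fP); lia.
Qed.

(** The 1 contributed by the new leaf cancels. Exchanging the sums over the insertion point and over
    the vertex [u] leaves, for each [u], an instance of [sum_spine_new_first_child] with
    [F k = x ^+ k]. *)
Lemma spine_weight_insert_leaf0 {n s} : tree_code n s ->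
  \sum_(v < n.+1) (spine_weight (insert_leaf s v 0) - (1 + spine_weight s)) =
  \sum_(u < n.+1) \sum_(i < (code_spine s u).+1)
    (x ^+ i.+1 - x ^+ code_spine s u).
Proof.
move=> sP; pose d' v := code_spine (insert_leaf s v 0).
under eq_bigr => v _.
  rewrite (spine_weight_insert_leaf _ _ sP) -1?ltnS // opprD addrACA subrr add0r.
  rewrite /spine_weight (tree_code_size _ _ sP) -sumrB.
over.
rewrite exchange_big; apply: eq_bigr => u _.
apply: (sum_spine_new_first_child (d' := d') (fun k => x ^+ k) u
  (first_child_increasing sP) (code_spineP sP) _ (ltn_ord u)) => v lt_v w.
rewrite /d' (code_spineP (insert_leafP 0 sP lt_v)) first_child_insert_leaf0.
  by rewrite (tree_code_size _ _ sP).
by rewrite (tree_code_size _ _ sP).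
Qed.

Variable K : R.
Hypothesis driftK : forall d, \sum_(i < d.+1) (x ^+ i.+1 - x ^+ d) <= K.

(** All 2n + 1 insertions are compared with the baseline [1 + spine_weight s]. Those that do not
    create a first child attain it exactly; the n + 1 others together deviate by at most [K] for
    each old vertex. *)
Lemma sum_spine_weight_insert_leaf {n s} : tree_code n s ->
  \sum_(v < n.+1) \sum_(i < (size (nth [::] s v)).+1)
    spine_weight (insert_leaf s v i)
  <= n.*2.+1%:R * (1 + spine_weight s) + n.+1%:R * K.
Proof.
move=> sP.
have -> : \sum_(v < n.+1) \sum_(i < (size (nth [::] s v)).+1)
      spine_weight (insert_leaf s v i) =
    n.*2.+1%:R * (1 + spine_weight s) +
    \sum_(v < n.+1) (spine_weight (insert_leaf s v 0) - (1 + spine_weight s)).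
  transitivity (\sum_(v < n.+1) ((size (nth [::] s v)).+1%:R * (1 + spine_weight s)
      + (spine_weight (insert_leaf s v 0) - (1 + spine_weight s)))).
    apply: eq_bigr => v _; rewrite big_ord_recl /=.
    under eq_bigr => i _ do rewrite (spine_weight_insert_leafS sP (ltn_ord v) (ltn_ord i)).
    by rewrite sumr_const card_ord -mulr_natl -[in RHS]natr1; ring.
  rewrite big_split /= -mulr_suml -natr_sum; congr (_%:R * _ + _).
  under eq_bigr do rewrite -addn1.
  by rewrite big_split /= (sum_size_children sP) sum1_card card_ord; lia.
rewrite lerD2l (spine_weight_insert_leaf0 sP).
apply: (@le_trans _ _ (\sum_(u < n.+1) K)); first by apply: ler_sum => u _.
by rewrite sumr_const card_ord mulr_natl.
Qed.

Lemma sum_spine_weight_le n : 0 <= K ->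
  \sum_(s <- tree_codes n) spine_weight s
  <= n.+1%:R * (1 + K) * (size (tree_codes n))%:R.
Proof.
move=> K0; elim: n => [|n IHn].
  by rewrite big_seq1 /spine_weight big_ord1 /code_spine /= expr0; lra.
rewrite sum_tree_codesS size_tree_codesS.
apply: (@le_trans _ _ (\sum_(s <- tree_codes n)
    (n.*2.+1%:R * (1 + spine_weight s) + n.+1%:R * K))).
  rewrite big_seq [leRHS]big_seq; apply: ler_sum => s /mem_tree_codes.
  exact: sum_spine_weight_insert_leaf.
rewrite big_split /= -mulr_sumr big_split /= !big_const_seq !count_predT !iter_addr_0.
rewrite -[n.+1%:R * K *+ _]mulr_natr natrM -[n.+2%:R]natr1.
set N := (size _)%:R in IHn *; set D := n.*2.+1%:R; set M := n.+1%:R in IHn *.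
have -> : (M + 1) * (1 + K) * (D * N) = D * (N + M * (1 + K) * N) + D * (K * N).
  by ring.
apply: lerD; first by rewrite ler_wpM2l ?ler0n // lerD2l.
(* Since n + 1 <= 2n + 1, the total drift [n.+1%:R * K] costs at most [K] on average over the
   insertions. *)
rewrite -mulrA ler_wpM2r ?mulr_ge0 ?ler0n // ler_nat; lia.
Qed.

End SpineWeight.

(** * Bijection between trees on n + 1 vertices and codes *)

Definition code_of_tree {n} (t : plane_inc_tree n) : seq (seq nat) :=
  [seq [seq val u | u <- children t v] | v <- enum 'I_n].

Lemma nth_code_of_tree {n} (t : plane_inc_tree n) (v : 'I_n) :
  nth [::] (code_of_tree t) v = [seq val u | u <- children t v].
Proof. by rewrite (nth_map v) ?size_enum_ord // nth_ord_enum. Qed.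

Lemma code_of_tree_inj n : injective (@code_of_tree n).
Proof.
move=> t t' eq_tt'; apply/val_inj/ffunP => v; apply: val_inj.
have := nth_code_of_tree t v; rewrite eq_tt' nth_code_of_tree.
by move/(inj_map val_inj).
Qed.

Lemma count_code_of_tree {n} (t : plane_inc_tree n) (u : 'I_n) :
  count_mem (val u) (flatten (code_of_tree t)) =
  (\sum_(v < n) count_mem u (children t v))%N.
Proof.
rewrite count_flatten sumnE 2!big_map big_enum /=; apply: eq_bigr => v _.
by rewrite count_map; apply: eq_count => w /=; rewrite val_eqE.
Qed.

Lemma code_of_treeP n (t : plane_inc_tree n.+1) : tree_code n (code_of_tree t).
Proof.
have /andP[/forallP tcount /forallP tlt] := svalP t.
split; first by rewrite size_map size_enum_ord.
  (* Multiplicities are compared label by label: the tree condition settles the labels up to [n],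
     and larger numbers occur on neither side. *)
  apply/allP => x _ /=; rewrite [X in _ == X]count_uniq_mem ?iota_uniq // mem_iota.
  have [lt_x|le_x] := ltnP x n.+1.
    rewrite -[x]/(val (Ordinal lt_x)) count_code_of_tree.
    rewrite (eqP (tcount (Ordinal lt_x))) /=.
    by rewrite andbT lt0n.
  rewrite andbF; apply/eqP/count_memPn/negP.
  case/flattenP => _ /mapP[v _ ->] /mapP[u _ eq_xu].
  by have := ltn_ord u; rewrite -[nat_of_ord u]/(val u) -eq_xu ltnNge le_x.
move=> v u; have [lt_v|le_v] := ltnP v n.+1; last first.
  by rewrite nth_default // size_map size_enum_ord.
rewrite -[v]/(val (Ordinal lt_v)) nth_code_of_tree => /mapP[w wv ->].
by have /allP/(_ w wv) := tlt (Ordinal lt_v).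
Qed.

Lemma code_of_tree_surj {n s} :
  tree_code n s -> exists t : plane_inc_tree n.+1, code_of_tree t = s.
Proof.
move=> sP.
pose c := [ffun v : 'I_n.+1 =>
  insub_bseq n.+1 [seq inord u : 'I_n.+1 | u <- nth [::] s v]].
(* [insub_bseq] would replace an overlong list by the empty one. This does not happen, because all
   child lists together have only [n] entries. *)
have cE v : c v = [seq inord u : 'I_n.+1 | u <- nth [::] s v] :> seq _.
  rewrite ffunE insubdK // unfold_in size_map.
  rewrite (leq_trans _ (leqnSn n)) // -[leqRHS](sum_size_children sP).
  by rewrite (bigD1 v) //= leq_addr.
(* Likewise [inord] never takes its default value, since every label in the code is below [n.+1]. *)
have cval v : [seq val u | u <- c v] = nth [::] s v.
  rewrite cE -map_comp; apply: map_id_in => u us /=; rewrite inordK //.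
  by have /andP[] := tree_code_ltn sP us.
have codeE : [seq [seq val u | u <- c v] | v <- enum 'I_n.+1] = s.
  apply: (@eq_from_nth _ [::]); rewrite size_map size_enum_ord.
    by rewrite (tree_code_size _ _ sP).
  move=> v lt_v; rewrite (nth_map ord0) ?size_enum_ord // cval.
  by rewrite nth_enum_ord.
have cP : plane_increasing c.
  apply/andP; split; apply/forallP => u.
    have -> : (\sum_(v < n.+1) count_mem u (c v))%N = count_mem (val u) (flatten s).
      rewrite -codeE count_flatten sumnE 2!big_map big_enum /=; apply: eq_bigr => v _.
      by rewrite count_map; apply: eq_count => w /=; rewrite val_eqE.
    rewrite (permP (tree_code_perm _ _ sP)) count_uniq_mem ?iota_uniq // mem_iota.
    by rewrite [(u < _)%N]ltn_ord andbT lt0n.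
  apply/allP => w /(map_f val); rewrite cval => /(tree_code_lt _ _ sP).
  exact.
by exists (exist _ c cP).
Qed.

Lemma perm_code_of_tree n :
  perm_eq [seq code_of_tree t | t : plane_inc_tree n.+1] (tree_codes n).
Proof.
apply: uniq_perm; last 1 first.
- move=> s; apply/mapP/idP => [[t _ ->]|/mem_tree_codes sP].
    exact/mem_tree_codes/code_of_treeP.
  by have [t <-] := code_of_tree_surj sP; exists t; rewrite ?mem_enum.
- by rewrite map_inj_uniq ?enum_uniq //; apply: code_of_tree_inj.
- exact: tree_codes_uniq.
Qed.

(** * Spines bound ranks, and the resulting moment bound *)

Lemma leaf_at_depth_code_spine n (t : plane_inc_tree n.+1) (v : 'I_n.+1) :
  leaf_at_depth t v (code_spine (code_of_tree t) v).
Proof.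
have sP := code_of_treeP n t.
have [m] := ubnP (n.+1 - v); elim: m v => // m IHm v lt_m.
rewrite (code_spineP sP) /first_child nth_code_of_tree.
case cv: (children t v) => [|u s] /=.
  by apply/existsP; exists [tuple]; rewrite /= /is_leaf cv.
have uv : child_of t v u by rewrite /child_of cv mem_head.
have lt_vu : (v < u)%N.
  by apply: (tree_code_lt _ _ sP); rewrite nth_code_of_tree; apply: map_f.
have [|p /andP[pp lp]] := existsP (IHm u _).
  by have := ltn_ord u; lia.
by apply/existsP; exists [tuple of u :: p]; rewrite /= uv pp.
Qed.

Lemma vertex_rank_le_spine n (t : plane_inc_tree n.+1) (v : 'I_n.+1) :
  (vertex_rank t v <= code_spine (code_of_tree t) v)%N.
Proof.
by rewrite /vertex_rank; case: ex_minnP => d _; apply; apply: leaf_at_depth_code_spine.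
Qed.

(** This is Markov's inequality: a vertex of rank above [k] has a spine at least as long as its
    rank, hence contributes at least [x ^+ k] to the weight, and all other contributions are
    nonnegative. *)
Lemma num_rank_gt_le {R : realType} (x : R) n (t : plane_inc_tree n.+1) k :
  1 <= x -> x ^+ k * (num_rank_gt t k)%:R <= spine_weight x (code_of_tree t).
Proof.
move=> x1; have x0 : 0 <= x by apply: le_trans x1.
rewrite /num_rank_gt -sum1_card natr_sum mulr_sumr /spine_weight.
rewrite (tree_code_size _ _ (code_of_treeP n t)).
rewrite [leRHS](bigID (fun v => k < vertex_rank t v)%N) /=.
rewrite -[leLHS]addr0 lerD //; last by apply: sumr_ge0 => v _; apply: exprn_ge0.
apply: ler_sum => v lt_kv; rewrite mulr1 ler_weXn2l //.
exact: leq_trans (ltnW lt_kv) (vertex_rank_le_spine _ _ _).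
Qed.

(** * Uniform drift constant and conclusion *)

(* The left side is at most x^d (x^2 / (x - 1) - (d + 1)), which is negative
   for large d. *)
Lemma spine_drift_bounded {R : realType} (x : R) : 1 < x ->
  exists2 K : R, 0 <= K & forall d, \sum_(i < d.+1) (x ^+ i.+1 - x ^+ d) <= K.
Proof.
move=> x1; have x0 : 0 < x by apply: lt_trans x1.
pose B := x ^+ 2 / (x - 1).
have B0 : 0 <= B by rewrite divr_ge0 ?exprn_ge0 ?subr_ge0 // ltW.
have [A ltBA] : exists A : nat, B < A%:R.
  by exists (Num.bound B); apply: le_lt_trans (archi_boundP B0); rewrite ?ler_norm.
(* With [B = x ^+ 2 / (x - 1)] and an integer [A > B], the drift is at most
   [x ^+ d * (B - (d + 1))]. For [d <= A] the subtracted part is dropped and [x ^+ d] is at most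
   [x ^+ A]; for [d > A] the bound is negative. *)
exists (x ^+ A * B); first by rewrite mulr_ge0 ?exprn_ge0 // ltW.
move=> d; rewrite sumrB sumr_const card_ord -[x ^+ d *+ _]mulr_natr.
have geo : \sum_(i < d.+1) x ^+ i.+1 <= x ^+ d * B.
  rewrite /B mulrA ler_pdivlMr ?subr_gt0 //.
  under eq_bigr do rewrite exprS.
  rewrite -mulr_sumr -mulrA [_ * (x - 1)]mulrC -subrX1 mulrBr mulr1.
  by rewrite exprS mulrA -expr2 mulrC gerBl ltW.
apply: le_trans (lerB geo (lexx _)) _; rewrite -mulrBr.
have [le_dA|lt_Ad] := leqP d A.
  apply: (@le_trans _ _ (x ^+ d * B)).
    by rewrite ler_wpM2l ?exprn_ge0 ?ltW // ltrBlDr ltrDl ltr0n.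
  by rewrite ler_wpM2r // ler_weXn2l // ltW.
apply: (@le_trans _ _ 0); last by rewrite mulr_ge0 ?exprn_ge0 // ltW.
rewrite mulr_ge0_le0 ?exprn_ge0 ?ltW // subr_lt0.
by apply: lt_le_trans ltBA _; rewrite ler_nat; lia.
Qed.

Lemma size_tree_codes_gt0 n : (0 < size (tree_codes n))%N.
Proof. by elim: n => // n IHn; rewrite size_tree_codesS muln_gt0. Qed.

Lemma card_plane_inc_tree n : #|{: plane_inc_tree n.+1}| = size (tree_codes n).
Proof. by rewrite -(perm_size (perm_code_of_tree n)) size_map -cardE. Qed.

Theorem theorem3p6 (R : realType) (r : R) (hr0 : 0 < r) (hr1 : r < 1) :
  exists C : R, forall k : nat,
    (ereal_sup [set (n%:R^-1 * expected_num_rank_gt R n k)%:E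
                 | n in [set n : nat | (1 <= n)%N]]
      <= (C * r ^+ k)%:E)%E.
Proof.
have x1 : 1 < r^-1 by rewrite invf_gt1.
have [K K0 driftK] := spine_drift_bounded _ x1.
(* [K] was obtained from [r] alone, before [k] and [n] are introduced, so the constant is uniform in
   both. *)
exists (1 + K) => k; apply: ge_ereal_sup => _ [[//|n] _ <-].
rewrite lee_fin ler_pdivrMl ?ltr0n // /expected_num_rank_gt card_plane_inc_tree.
rewrite ler_pdivrMr ?ltr0n ?size_tree_codes_gt0 //.
(* The total spine weight with base 1/r, scaled by [r ^+ k], lies between the two sides: the moment
   bound is applied tree by tree below it, the bound on the summed weight above it. *)
apply: (@le_trans _ _ (r ^+ k * \sum_(s <- tree_codes n) spine_weight r^-1 s)); last first.
  apply: le_trans (ler_wpM2l (exprn_ge0 _ (ltW hr0)) (sum_spine_weight_le _ _ driftK n K0)) _.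
  by rewrite le_eqVlt; apply/orP; left; apply/eqP; ring.
rewrite -(perm_big _ (perm_code_of_tree n)) big_map big_enum /= mulr_sumr.
apply: ler_sum => t _; rewrite -ler_pdivrMl ?exprn_gt0 // -exprVn.
exact: num_rank_gt_le (ltW x1).
Qed.
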